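(* Let $\lambda$ be an infinite cardinal, let $X$ be a Hausdorff space with $|X|>1$, let $\phi\in\{w,nw\}$, suppose $o(X)=2^{\phi(X)}$, and put $\mu:=o(X^\lambda)$. Then for every $\mathsf{A}\in\{\mathsf{C},\mathsf{P},\mathsf{WP}\}$ the following hold: (1) $\mathsf{A}(X^{\lambda})=\{\kappa\in\mathsf{A}(X) : \mathrm{cf}(\kappa)>\omega\}$. (2) $\mathsf{A}^*(X^{\lambda}) = \{\kappa\in\mathsf{CN} : \kappa> \mu\}\cup \{\kappa\in\mathsf{A}(X) : \kappa\leq \mu \text{ and } \mathrm{cf}(\kappa)>\omega\}$.
   Context: $\mathsf{CN}$ is the class of infinite cardinals. For a topological space $X$, $\tau_X$ is its topology, $\tau_X^+=\tau_X\setminus\{\emptyset\}$, $o(X)=|\tau_X|$, and $X^\lambda$ is the topological power with the product topology. $w(X)$ and $nw(X)$ are the weight and the network weight of $X$, taken to be infinite cardinals (i.e. $\omega$ plus the minimal size of a base, respectively of a network). A family of sets is centered if every non-empty finite subfamily has non-empty intersection, and a family in $\tau_X^+$ is linked if any two members intersect. An infinite cardinal $\kappa$ is a caliber (resp. precaliber; weak precaliber) for $X$ if for every indexed family $\{U_\alpha:\alpha<\kappa\}\subseteq\tau_X^+$ (repetitions allowed) there is $J\subseteq\kappa$ with $|J|=\kappa$ such that $\bigcap_{\alpha\in J}U_\alpha\ne\emptyset$ (resp. $\{U_\alpha:\alpha\in J\}$ is centered; is linked). It is a caliber* (resp. precaliber*; weak precaliber* ) for $X$ if for every set $\mathcal U\subseteq\tau_X^+$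 with $|\mathcal U|=\kappa$ there is $\mathcal V\subseteq\mathcal U$ with $|\mathcal V|=\kappa$ and $\bigcap\mathcal V\neq\emptyset$ (resp. $\mathcal V$ centered; linked). $\mathsf C(X),\mathsf P(X),\mathsf{WP}(X)$ are the classes of calibers, precalibers, weak precalibers of $X$, and $\mathsf C^*(X),\mathsf P^*(X),\mathsf{WP}^*(X)$ are the classes of calibers*, precalibers*, weak precalibers* of $X$. *)

(* Defs.v *)
From mathcomp Require Import all_boot.
From mathcomp Require Import all_classical wochoice topology.

Set Implicit Arguments.
Unset Strict Implicit.
Unset Printing Implicit Defensive.

Local Open Scope classical_set_scope.
Local Open Scope card_scope.

Definition card_lt T U (A : set T) (B : set U) : Prop :=
  A #<= B /\ ~ (B #<= A).
Notation "A '#<' B" := (card_lt A B) (at level 79) : card_scope.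

(* A member of [P] of least cardinality, standing for the cardinal
   min {|A| : A in P}; cardinals are compared by [#<=], [#=] and [#<] only, so
   the choice of the representative is immaterial. The default [set0] is
   never used when [P] is inhabited, see [min_cardP]. *)
Definition min_card T (P : set (set T)) : set T :=
  xget set0 [set A | P A /\ forall B, P B -> A #<= B].

Lemma min_cardP T (P : set (set T)) : P !=set0 ->
  P (min_card P) /\ forall B, P B -> min_card P #<= B.
Proof.
move=> [A0 PA0].
suff [A mA] : exists A, P A /\ forall B, P B -> A #<= B.
  by rewrite /min_card; case: xgetP => [_ _ //|/(_ A)].
pose I := {A : set T | P A}.
pose good (S : set (I -> T)) := forall i : I,
  (forall f, S f -> sval i (f i)) /\
  (forall f g, S f -> S g -> f i = g i -> f = g).
have [|S [gS maxS]] := @Zorn_bigcup (I -> T) good.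
  move=> F sF tF i; split=> [f [X FX Xf]|f g [X FX Xf] [Y FY Yg]].
    by have [+ _] := sF _ FX i; apply.
  have [XY|YX] := tF _ _ FX FY.
  - by have [_] := sF _ FY i; apply=> //; exact: XY.
  - by have [_] := sF _ FX i; apply=> //; exact: YX.
have [i iS] : exists i : I, forall t, sval i t -> exists2 f, S f & f i = t.
  apply: contrapT => /forallNP nS.
  have /choice[h hP] : forall i : I, exists t,
      sval i t /\ forall f, S f -> f i <> t.
    move=> i; have /existsNP[t /not_implyP[it nt]] := nS i.
    by exists t; split=> // f Sf fit; apply: nt; exists f.
  have Sh : ~ S h by move=> /((hP (exist _ A0 PA0)).2).
  apply: (maxS (S `|` [set h])).
    split; first by move=> f; left.
    by move=> /(_ h) hS; apply/Sh/hS; right.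
  move=> j; split=> [f [Sf|->]|f g].
  - by have [+ _] := gS j; apply.
  - exact: (hP j).1.
  - move=> [Sf|->] [Sg|->] // e; first by have [_] := gS j; apply.
    + by have := (hP j).2 _ Sf e.
    + by have := (hP j).2 _ Sg (esym e).
exists (sval i); split=> [|B PB]; first exact: (svalP i).
have -> : sval i = (fun f : I -> T => f i) @` S.
  apply/seteqP; split=> [t /iS[f Sf <-]|_ [f Sf <-]]; first by exists f.
  by have [+ _] := gS i; apply.
pose j : I := exist _ B PB.
have inj k : {in S &, injective (fun f : I -> T => f k)}.
  by move=> f g /set_mem Sf /set_mem Sg; have [_] := gS k; apply.
rewrite (card_le_eql (inj_card_eq (inj i))).
rewrite -(card_le_eql (inj_card_eq (inj j))).
apply: subset_card_le => _ [f Sf <-].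
by have [+ _] := gS j; apply.
Qed.

(* Infinite cardinals are initial ordinals: well-ordered infinite types all of
   whose proper initial segments have strictly smaller cardinality. *)
Record infinite_cardinal := InfiniteCardinal {
  points :> Type;
  ord_le : rel points;
  ord_le_wo : well_order ord_le;
  ord_le_initial : forall a : points,
    [set b | ord_le b a /\ b <> a] #< [set: points];
  points_infinite : infinite_set [set: points]
}.

Definition cofinal (k : infinite_cardinal) (S : set k) :=
  forall a : k, exists2 b, S b & ord_le a b.

Definition cf (k : infinite_cardinal) : set k := min_card (@cofinal k).
Arguments cf : clear implicits.

Section CardinalFunctions.
Variable X : topologicalType.

Definition opens : set (set X) := [set U | open U].

Definition nonempty_opens : set (set X) := [set U | open U /\ U !=set0].

Definition network (N : set (set X)) :=
  forall x U, open U -> U x -> exists2 A, N A & A x /\ A `<=` U.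

(* The disjoint sum with [nat] makes the two cardinals infinite. *)
Definition weight : Type := (nat + min_card (@basis X))%type.

Definition network_weight : Type := (nat + min_card network)%type.

End CardinalFunctions.
Arguments opens : clear implicits.
Arguments nonempty_opens : clear implicits.

Section SetFamilies.
Variables (T : Type) (F : set (set T)).

Definition has_common_point := \bigcap_(A in F) A !=set0.

Definition centered := forall G : set (set T),
  finite_set G -> G !=set0 -> G `<=` F -> \bigcap_(A in G) A !=set0.

Definition linked := forall A B, F A -> F B -> A `&` B !=set0.

End SetFamilies.

Variant caliber_kind := Caliber | Precaliber | WeakPrecaliber.

Definition family_prop (A : caliber_kind) T : set (set T) -> Prop :=
  match A with
  | Caliber => @has_common_point T
  | Precaliber => @centered T
  | WeakPrecaliber => @linked T
  end.

(* Classes of cardinals are predicates on [infinite_cardinal] and are compared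
   pointwise; encoding them as [set infinite_cardinal] would force the cardinals
   into a strictly smaller universe than the spaces. *)
Section CaliberClasses.
Variables (A : caliber_kind) (X : topologicalType).

Definition calibers (k : infinite_cardinal) : Prop :=
  forall U : k -> set X, (forall a, nonempty_opens X (U a)) ->
  exists2 J : set k, J #= [set: k] & family_prop A (U @` J).

Definition calibers_star (k : infinite_cardinal) : Prop :=
  forall UU : set (set X), UU `<=` nonempty_opens X -> UU #= [set: k] ->
  exists VV : set (set X),
    [/\ VV `<=` UU, VV #= [set: k] & family_prop A VV].

End CaliberClasses.

(* Main.v *)
Require Import Defs.
From mathcomp Require Import all_boot.
From mathcomp Require Import all_classical wochoice topology.

Set Implicit Arguments.
Unset Strict Implicit.
Unset Printing Implicit Defensive.

Local Open Scope classical_set_scope.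
Local Open Scope card_scope.

(** Everything rests on the equality of (1): [k] has the property for the power
    [X^lambda] iff it has it for [X] and [cf k] is uncountable.

    Necessity is quick. An open family of [X] pulls back along a coordinate
    ([calibers_factor]). The power has infinitely many pairwise disjoint open
    sets [V n] ([disjoint_opens_power]); if [cf k] were countable, [k] would be
    a countable union of small pieces, and the family equal to [V n] on the
    [n]-th piece would have no linked subfamily of size [k]
    ([calibers_uncountable_cf]).

    Sufficiency must also handle singular [k], for which a family of [k] finite
    supports need not contain a Delta-system of size [k]. The way out is to
    merge coordinates. If [q : lambda -> nat] is injective on the support of
    each of a family of boxes, then points [t c], one per colour [c], chosen
    in the sides of colour [c], yield the common point [i |-> t (q i)]. When
    moreover only finitely many colours occur, finitely many applications of
    the hypothesis on [X] produce these points, whence [calibers_power]. So the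
    whole matter is combinatorial: theorem [coloring] says that, if [cf k] is
    uncountable, any [k] finite sets contain [k] many on each of which one
    common [nat]-valued colouring is injective.

    To prove [coloring], a repeated maximal disjoint subfamily argument shows
    that [k] many of the sets are disjoint outside some set [D] of size less
    than [k] ([disjoint_outside_small]); outside [D] they are easy to colour,
    and the traces on [D] take fewer than [k] values. If some value is taken
    [k] times, it is enough to colour that one finite set; this always happens
    when [k] is regular. Otherwise let [nu] be the cofinality of [k], and
    choose for each [i < nu] a trace whose fibre is larger than the [i]-th term
    of a sequence cofinal in [k]. The regular case colours [nu] many of these
    traces at once, and the union of their fibres has size [k]
    ([small_colorable_cofinal]).

    For (2), a cardinal above [mu] qualifies vacuously, and a caliber is a
    caliber* by enumeration. For the converse when [k <= mu], replace the given
    opens [U a], with possible repetitions, by the products [U a * W a] inside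
    [X^lambda * X^lambda], which is [X^lambda] as [lambda + lambda = lambda],
    where the [W a] are [k] distinct nonempty opens ([calibers_of_star]). The
    products are distinct, so the starred property applies to them, and
    projecting gives the unstarred one. *)

(** * Comparison of cardinals *)

Lemma fun_card_le T U (A : set T) (B : set U) (f : T -> U) :
  (forall x, A x -> B (f x)) ->
  (forall x y, A x -> A y -> f x = f y -> x = y) -> A #<= B.
Proof.
move=> fAB finj; have : $|{injfun A >-> B}|.
  by apply/injfunPex; exists f => // x y /set_mem + /set_mem; exact: finj.
by case=> g; exact: inj_card_le g.
Qed.

Lemma card_le_fun T U (u0 : U) (A : set T) (B : set U) : A #<= B ->
  exists f : T -> U, (forall x, A x -> B (f x)) /\
    (forall x y, A x -> A y -> f x = f y -> x = y).
Proof.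
move=> /card_leP[f].
pose g x := if pselect (A x) is left Ax then val (f (SigSub (mem_set Ax))) else u0.
exists g; split=> [x Ax|x y Ax Ay]; rewrite /g.
  by case: pselect => // ?; exact: set_valP.
case: pselect => // {}Ax; case: pselect => // {}Ay /val_inj.
move=> /(@inj _ _ _ f) /=.
by rewrite !in_setT => /(_ isT isT) [].
Qed.

(** [min_card] selects among the two copies of [A] and [B] in a disjoint sum one
    that embeds in the other. *)
Lemma card_le_total T U (A : set T) (B : set U) : A #<= B \/ B #<= A.
Proof.
have injT : @inl T U @` A #= A by apply: inj_card_eq => x y _ _ [].
have injU : @inr T U @` B #= B by apply: inj_card_eq => x y _ _ [].
pose P : set (set (T + U)) := [set inl @` A; inr @` B].
have [|[] -> minP] := @min_cardP _ P; first by exists (inl @` A); left.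
- left; rewrite -(card_le_eql injT) -(card_le_eqr injU).
  by apply: minP; right.
- right; rewrite -(card_le_eqr injT) -(card_le_eql injU).
  by apply: minP; left.
Qed.

Lemma card_ltNge T U (A : set T) (B : set U) : A #< B <-> ~ (B #<= A).
Proof.
by split=> [[]//|nBA]; split=> //; have [|/nBA] := card_le_total A B.
Qed.

Lemma card_le_lt_trans T U V (B : set U) (A : set T) (C : set V) :
  A #<= B -> B #< C -> A #< C.
Proof.
move=> AB /card_ltNge CB; apply/card_ltNge => /card_le_trans/(_ AB); exact: CB.
Qed.

Lemma card_lt_le_trans T U V (B : set U) (A : set T) (C : set V) :
  A #< B -> B #<= C -> A #< C.
Proof.
by move=> /card_ltNge AB BC; apply/card_ltNge => /(card_le_trans BC).
Qed.

Lemma card_lt_finite T U (A : set T) (B : set U) :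
  infinite_set B -> finite_set A -> A #< B.
Proof. by move=> iB fA; apply/card_ltNge => /card_le_finite/(_ fA). Qed.

(** The square of an infinite cardinal. Zorn's lemma is applied to injections
    [S * S -> S] with [S] a subset of [A], encoded by their graphs. If [S] is
    maximal then it does not embed in its complement, since a copy [e @` S] of
    [S] there would leave room to extend the injection to the square of
    [S `|` e @` S]; hence [A] embeds in the sum of two copies of [S], thus in
    [S * S], and finally in [S]. *)
Lemma infinite_square_le T (A : set T) : infinite_set A -> A `*` A #<= A.
Proof.
move=> infA.
have [t0 _] := infinite_setN0 infA.
have [g [gA ginj]] := card_le_fun t0 ((infiniteP A).1 infA).
pose dom (R : set (T * T * T)) := [set x | exists z, R (x, x, z)].
pose good (R : set (T * T * T)) := [/\ dom R `<=` A,
  forall x y z, R (x, y, z) -> [/\ dom R x, dom R y & dom R z],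
  forall x y, dom R x -> dom R y -> exists z, R (x, y, z) &
  forall x y x' y' z, R (x, y, z) -> R (x', y', z) -> x = x' /\ y = y'].
pose R0 := [set p : T * T * T |
  exists i j : nat, p = (g i, g j, g (pickle (i, j)))].
have good0 : good R0.
  split=> [_ [z [i [j []]]] -> _ _|x y z [i [j [-> -> ->]]]|
           x y [_ [i [_ [-> _ _]]]] [_ [j [_ [-> _ _]]]]|
           x y x' y' z [i [j [-> -> ->]]] [i' [j' [-> ->]]]].
  - exact: gA.
  - by split; eexists; do 2!eexists; reflexivity.
  - by eexists; do 2!eexists; reflexivity.
  - move=> /ginj - /(_ I I) /(pcan_inj pickleK) [-> ->] //.
(* Joining the fixed graph [R0] to every candidate keeps the domains infinite,
   also for the union of the empty chain. *)
have [|R [goodR maxR]] := @Zorn_bigcup _ [set R | good (R0 `|` R)].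
  move=> F Fgood Ftot /=; set S := R0 `|` _.
  have two p q : S p -> S q -> exists Y, [/\ good Y, Y `<=` S, Y p & Y q].
    have sub X : F X -> R0 `|` X `<=` S.
      by move=> FX r [|Xr]; [left|right; exists X].
    move=> [R0p|[X FX Xp]] [R0q|[Y FY Yq]].
    - by exists R0; split=> // r; left.
    - by exists (R0 `|` Y); split; [exact: Fgood|exact: sub|left|right].
    - by exists (R0 `|` X); split; [exact: Fgood|exact: sub|right|left].
    - have [XY|YX] := Ftot _ _ FX FY.
        exists (R0 `|` Y); split; [exact: Fgood|exact: sub| |by right].
        by right; exact: XY.
      exists (R0 `|` X); split; [exact: Fgood|exact: sub|by right|].
      by right; exact: YX.
  have domS Y : Y `<=` S -> dom Y `<=` dom S.
    by move=> YS x [z /YS Sz]; exists z.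
  split=> [x [z Sz]|x y z Sz|x y [z Sz] [z' Sz']|x y x' y' z Sz Sz'].
  - by have [Y [[dA _ _ _] _ Yz _]] := two _ _ Sz Sz; apply: dA; exists z.
  - have [Y [[_ /(_ _ _ _) dY _ _] YS Yz _]] := two _ _ Sz Sz.
    by have [? ? ?] := dY _ _ _ Yz; split; exact: domS YS _ _.
  - have [Y [[_ _ tY _] YS Yz Yz']] := two _ _ Sz Sz'.
    have [||w Yw] := tY x y; [by exists z|by exists z'|].
    by exists w; exact: YS.
  - have [Y [[_ _ _ iY] YS Yz Yz']] := two _ _ Sz Sz'.
    exact: iY Yz Yz'.
move: goodR maxR; set Q := R0 `|` R => goodQ maxR.
have {}maxR Q' : good Q' -> Q `<=` Q' -> Q' `<=` Q.
  move=> gQ' QQ'; apply: contrapT => nQQ.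
  apply: (maxR Q'); last first.
    by rewrite /= setUidr // => x R0x; apply: QQ'; left.
  split; first by move=> x Rx; apply: QQ'; right.
  by move=> Q'R; apply: nQQ => x /Q'R; right.
have {good0}R0Q : R0 `<=` Q by left.
have [dA dQ tQ iQ] := goodQ; set S := dom Q in dA dQ tQ *.
have gS i : S (g i).
  by exists (g (pickle (i, i))); apply: R0Q; exists i, i.
have /choice[r rP] : forall p : T * T,
    exists z, S p.1 -> S p.2 -> Q (p.1, p.2, z).
  move=> [x y]; have [[Sx Sy]|nS] := pselect (S x /\ S y).
    by have [z Qz] := tQ _ _ Sx Sy; exists z.
  by exists x => Sx Sy; case: nS.
have rS x y : S x -> S y -> S (r (x, y)).
  by move=> Sx Sy; have [] := dQ _ _ _ (rP (x, y) Sx Sy).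
have rI x y x' y' : S x -> S y -> S x' -> S y' -> r (x, y) = r (x', y') ->
    x = x' /\ y = y'.
  move=> Sx Sy Sx' Sy' e; apply: (iQ _ _ _ _ (r (x, y))).
    exact: (rP (_, _)).
  by rewrite e; exact: (rP (_, _)).
have [SAS|/(card_le_fun t0)[e [eS eI]]] := card_le_total S (A `\` S).
  have [e [eS eI]] := card_le_fun t0 SAS.
  exfalso.
  (* Pairs not both in [S] are sent into [e @` S]: [s b b'] records which of
     the two components lie in [e @` S]. *)
  pose t (b : bool) x := if b then e x else x.
  pose s (b b' : bool) := g (b + b'.*2).
  pose c b b' x y := e (r (s b b', r (x, y))).
  pose Q' := Q `|` [set p | exists b b' x y,
    [/\ b || b', S x, S y & p = (t b x, t b' y, c b b' x y)]].
  have domQ' z : dom Q' z <-> S z \/ exists2 x, S x & z = e x.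
    split.
      move=> [w [Qw|[b [b' [x [y [_ Sx _ [-> _ _]]]]]]]]; first by left; exists w.
      by case: b => /=; [right; exists x|left].
    move=> [Sz|[x Sx ->]].
      by have [w Qw] := tQ _ _ Sz Sz; exists w; left.
    by exists (c true true x x); right; exists true, true, x, x.
  have tdom b x : S x -> dom Q' (t b x).
    by move=> Sx; apply/domQ'; case: b => /=; [right; exists x|left].
  have sS b b' : S (s b b') by exact: gS.
  have cS b b' x y : S x -> S y -> S (r (s b b', r (x, y))).
    by move=> *; apply: (rS) => //; exact: rS.
  have good' : good Q'.
    split.
    - move=> z /domQ'[/dA//|[x Sx ->]]; exact: (eS _ Sx).1.
    - move=> x y z [Qz|[b [b' [x' [y' [_ Sx Sy [-> -> ->]]]]]]].
        by have [? ? ?] := dQ _ _ _ Qz; split; apply/domQ'; left.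
      split; [exact: tdom|exact: tdom|].
      by apply/domQ'; right; eexists; last reflexivity; exact: cS.
    - move=> x y dx dy.
      have tx z : dom Q' z -> exists b x, S x /\ z = t b x.
        by move=> /domQ'[Sz|[w Sw ->]]; [exists false, z|exists true, w].
      have [b [x' [Sx ->]]] := tx _ dx; have [b' [y' [Sy ->]]] := tx _ dy.
      have [bb|] := boolP (b || b').
        by exists (c b b' x' y'); right; exists b, b', x', y'.
      case: b b' => [] [] //= _; have [z Qz] := tQ _ _ Sx Sy.
      by exists z; left.
    - have mixed b b' x y x' y' : S x -> S y ->
          ~ Q (x', y', c b b' x y).
        move=> Sx Sy /dQ[_ _]; exact: (eS _ (cS _ _ _ _ _ _)).2.
      move=> x y x' y' z [Qz|[b [b' [u [v [_ Su Sv [-> -> ->]]]]]]]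
        [Qz'|[d [d' [u' [v' [_ Su' Sv' [-> ->]]]]]]].
      - exact: iQ Qz Qz'.
      - by move=> ez; move: Qz; rewrite ez => /mixed - /(_ Su' Sv').
      - by move/mixed: Qz' => /(_ Su Sv).
      - move=> /eI - /(_ (cS _ _ _ _ Su Sv) (cS _ _ _ _ Su' Sv')).
        move=> /rI[||||]; [exact: sS|exact: rS|exact: sS|exact: rS|].
        move=> /ginj - /(_ I I) bb /rI[//|//|//|//|<- <-].
        by move: bb; case: b b' d d' => [] [] [] [].
  have /(maxR _ good') Q'Q : Q `<=` Q' by left.
  have : Q (e (g 0%N), e (g 0%N), c true true (g 0%N) (g 0%N)).
    apply: Q'Q; right; exists true, true, (g 0%N), (g 0%N); split=> //; exact: gS.
  by move=> /dQ[+ _ _]; exact: (eS _ (gS _)).2.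
pose h x := if pselect (S x) is left _ then r (g 0%N, x) else r (g 1%N, e x).
have hS x : A x -> S (h x).
  rewrite /h => Ax; case: pselect => Sx; first exact: rS.
  by apply: rS => //; exact: eS.
have hI x y : A x -> A y -> h x = h y -> x = y.
  move=> Ax Ay; rewrite /h; case: pselect => Sx; case: pselect => Sy.
  - by move=> /rI[].
  - by move=> /rI[//|//|//||/ginj - /(_ I I)//]; exact: eS.
  - by move=> /rI[//||//|//|/ginj - /(_ I I)//]; exact: eS.
  - move=> /rI[//||//||_]; [exact: eS|exact: eS|].
    by apply: eI.
apply: (@fun_card_le _ _ _ _ (fun p => r (h p.1, h p.2))).
  by move=> [x y] [/= Ax Ay]; apply/dA/rS; exact: hS.
move=> [x y] [x' y'] [/= Ax Ay] [/= Ax' Ay'] /rI[||||]; try exact: hS.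
by move=> /hI -> // /hI ->.
Qed.

Lemma card_ltX T T' U (A : set T) (A' : set T') (K : set U) :
  infinite_set K -> A #< K -> A' #< K -> A `*` A' #< K.
Proof.
move=> infK AK A'K.
have [->|/set0P[a0 _]] := eqVneq A set0.
  by rewrite set0X; exact: card_lt_finite.
have [->|/set0P[a0' _]] := eqVneq A' set0.
  by rewrite setX0; exact: card_lt_finite.
have square V (B : set V) : B #< K -> B `*` B #< K.
  move=> BK; have [finB|infB] := pselect (finite_set B).
    by apply: card_lt_finite => //; exact: finite_setX.
  exact: card_le_lt_trans (infinite_square_le infB) BK.
have [AA'|A'A] := card_le_total A A'.
- apply: card_le_lt_trans (square _ _ A'K).
  have [f [fA' fI]] := card_le_fun a0' AA'.
  apply: (@fun_card_le _ _ _ _ (fun p => (f p.1, p.2))).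
    by move=> [x y] [/= /fA'].
  by move=> [x y] [x' y'] [/= ? ?] [/= ? ?] [/fI -> // ->].
- apply: card_le_lt_trans (square _ _ AK).
  have [f [fA fI]] := card_le_fun a0 A'A.
  apply: (@fun_card_le _ _ _ _ (fun p => (p.1, f p.2))).
    by move=> [x y] [/= ? /fA].
  by move=> [x y] [x' y'] [/= ? ?] [/= ? ?] [-> /fI ->].
Qed.

(** Fewer than [K] sets of a common size below [K] have a union of size below
    [K]; the uniform bound [B] is what makes this hold for singular [K]. *)
Lemma card_lt_bigcup I T U V (A : set I) (G : I -> set T) (B : set U)
    (K : set V) : infinite_set K -> A #< K -> B #< K ->
  (forall i, A i -> G i #<= B) -> \bigcup_(i in A) G i #< K.
Proof.
move=> infK AK BK GB.
have [->|/set0P[t0 [i0 Ai0 Gt0]]] := eqVneq (\bigcup_(i in A) G i) set0.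
  exact: card_lt_finite.
have [B0|/set0P[b0 _]] := eqVneq B set0.
  by have := GB _ Ai0; rewrite B0 => /card_le0P Gi0; move: Gt0; rewrite Gi0.
apply: card_le_lt_trans (card_ltX infK AK BK).
have /choice[f fP] : forall i, exists f : T -> U, A i ->
    (forall x, G i x -> B (f x)) /\
    (forall x y, G i x -> G i y -> f x = f y -> x = y).
  move=> i; have [Ai|] := pselect (A i); last by exists (cst b0).
  by have [f fP] := card_le_fun b0 (GB _ Ai); exists f.
have /choice[h hP] : forall x, exists i, (\bigcup_(i in A) G i) x -> A i /\ G i x.
  move=> x; have [[i Ai Gx]|] := pselect ((\bigcup_(i in A) G i) x).
    by exists i.
  by exists i0.
apply: (@fun_card_le _ _ _ _ (fun x => (h x, f (h x) x))).
  by move=> x /hP[Ah Gh]; split=> //=; exact: (fP _ Ah).1.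
move=> x y /hP[Ax Gx] /hP[Ay Gy] [e]; rewrite -e in Gy *.
exact: (fP _ Ax).2.
Qed.

Lemma card_ltU T U (A B : set T) (K : set U) :
  infinite_set K -> A #< K -> B #< K -> A `|` B #< K.
Proof.
move=> infK AK BK.
have -> : A `|` B = \bigcup_(b in [set: bool]) (if b then A else B).
  apply/seteqP; split=> [x [Ax|Bx]|x [[] _ xAB]]; [| |by left|by right].
    by exists true.
  by exists false.
have fin : [set: bool] #< K by apply: card_lt_finite => //; exact: finite_finset.
have [AB|BA] := card_le_total A B.
  by apply: (card_lt_bigcup infK fin BK) => -[].
by apply: (card_lt_bigcup infK fin AK) => -[].
Qed.

Lemma card_lt_seq (T : eqType) U (D : set T) (K : set U) n :
  infinite_set K -> D #< K -> [set s : seq T | size s = n /\ [set` s] `<=` D] #< K.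
Proof.
move=> infK DK; elim: n => [|n IHn].
  apply: card_lt_finite => //; apply: (@sub_finite_set _ _ [set [::]]) => //.
  by move=> [|? ?] [].
have /(card_le_lt_trans _) := card_ltX infK DK IHn; apply.
apply: card_le_trans (card_image_le (fun p => p.1 :: p.2) _).
apply: subset_card_le => -[|x s] [//= [sn] sD]; exists (x, s) => //; split=> /=.
  by apply: sD; rewrite /= mem_head.
by split=> // y /= ys; apply: sD; rewrite /= inE ys orbT.
Qed.

(** * Infinite cardinals as initial well-orders *)

Section WellOrder.
Variables (T : Type) (R : rel T).
Hypothesis Rwo : well_order R.
Implicit Types a b c : T.

Lemma wo_least (P : set T) : P !=set0 ->
  exists a, P a /\ forall b, P b -> R a b.
Proof.
move=> [x Px]; pose p : {pred T} := fun a => `[< P a >].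
have [|a [[/asboolP Pa amin] _]] := @Rwo p; first by exists x; exact/asboolP.
by exists a; split=> // b Pb; apply: amin; exact/asboolP.
Qed.

Lemma wo_total a b : R a b \/ R b a.
Proof.
have [|m [[]-> minm]] := @wo_least [set a; b]; first by exists a; left.
  by left; apply: minm; right.
by right; apply: minm; left.
Qed.

Lemma wo_refl a : R a a.
Proof. by case: (wo_total a a). Qed.

Lemma wo_anti a b : R a b -> R b a -> a = b.
Proof.
move=> ab ba; pose p : {pred T} := fun c => `[< c = a \/ c = b >].
have [|m [_ minm]] := @Rwo p; first by exists a; apply/asboolP; left.
have minab c : R c a -> R c b -> p c -> m = c.
  by move=> ca cb pc; apply: minm; split=> // d /asboolP[] ->.
rewrite -(minab a) //; [|exact: wo_refl|by apply/asboolP; left].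
by apply: minab => //; [exact: wo_refl|apply/asboolP; right].
Qed.

Lemma wo_trans a b c : R a b -> R b c -> R a c.
Proof.
move=> ab bc; have [|m [[[]|] -> minm]] := @wo_least [set a; b; c].
- by exists a; left; left.
- by apply: minm; right.
- by rewrite (@wo_anti a b) //; apply: minm; left; left.
- by rewrite -(@wo_anti b c) //; apply: minm; left; right.
Qed.

Definition segment a : set T := [set b | ~ R a b].

Lemma segmentS a b : R a b -> segment a `<=` segment b.
Proof. by move=> ab c ac bc; apply: ac; exact: wo_trans bc. Qed.

End WellOrder.

(** Well-order [A]. Either all its proper initial segments are smaller than [A],
    or the least initial segment that is not smaller, which is equipotent with
    [A], has this property. *)
Lemma exists_infinite_cardinal T (A : set T) : infinite_set A ->
  exists k : infinite_cardinal, [set: k] #= A.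
Proof.
move=> infA; pose V := {classic A}.
have [R Rwo] := well_ordering_principle V.
have build (D : set V) : D #= A -> (forall b, D b -> D `&` segment R b #< D) ->
    exists k : infinite_cardinal, [set: k] #= A.
  move=> DA segD; pose W : Type := D; pose Q : rel W := fun x y => R (val x) (val y).
  have Qwo : well_order Q.
    move=> p [x px].
    have [|a [[Da pa] mina]] := @wo_least _ R Rwo
        [set y : V | exists Dy : D y, p (SigSub (mem_set Dy))].
      by exists (val x), (set_valP x); rewrite (_ : SigSub _ = x)//; exact: val_inj.
    exists (SigSub (mem_set Da)); split.
      split=> // y py; apply: mina; exists (set_valP y).
      by rewrite (_ : SigSub _ = y)//; exact: val_inj.
    move=> y [py miny]; apply: val_inj; apply: (wo_anti Rwo).
      apply: mina; exists (set_valP y).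
      by rewrite (_ : SigSub _ = y)//; exact: val_inj.
    exact: miny.
  have Qinit (a : W) : [set b | Q b a /\ b <> a] #< [set: W].
    have [DaD nDaD] := segD (val a) (set_valP a).
    apply: (@card_lt_le_trans _ _ _ D); last first.
      by rewrite -(card_le_eqr (card_setT_sym D)).
    apply: card_le_lt_trans (segD (val a) (set_valP a)).
    apply: (@fun_card_le _ _ _ _ (val : W -> V)); last by move=> ? ? _ _ /val_inj.
    move=> b [ba nba]; split; first exact: set_valP.
    by move=> ab; apply: nba; apply: val_inj; exact: (wo_anti Rwo).
  have Winf : infinite_set [set: W].
    by rewrite (eq_finite_set (card_setT D)) (eq_finite_set DA).
  exists (InfiniteCardinal Qwo Qinit Winf).
  exact: card_eq_trans (card_setT D) DA.
have VA : [set: V] #= A by exact: card_setT.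
have [small|/existsNP nsmall] := pselect (forall b, segment R b #< [set: V]).
  by apply: (build _ VA) => b _; rewrite setTI.
have [a [/card_ltNge/contrapT big mina]] := @wo_least _ R Rwo
  [set b | ~ (segment R b #< [set: V])] nsmall.
have aV : segment R a #= [set: V] by rewrite card_eq_le big card_leT.
apply: (build (segment R a)); first exact: card_eq_trans aV VA.
move=> b ab; apply: (@card_lt_le_trans _ _ _ [set: V]) => //.
apply: (@card_le_lt_trans _ _ _ (segment R b)).
  by apply: subset_card_le => x [].
by apply: contrapT => nb; apply: ab; exact: mina.
Qed.

Section InfiniteCardinalOrder.
Variable k : infinite_cardinal.
Implicit Types a b c : k.
Let wo := @ord_le_wo k.

Lemma segment_lt a : segment (@ord_le k) a #< [set: k].
Proof.
apply: card_le_lt_trans (ord_le_initial a); apply: subset_card_le => b ab.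
by split; [case: (wo_total wo a b)|move=> ba; apply: ab; rewrite ba; exact: (wo_refl wo)].
Qed.

(** If no proper initial segment accommodates [A], a maximal injection from an
    initial segment of [k] to [A] never exhausts [A], so it is defined on all
    of [k] and [A] is not smaller than [k]. *)
Lemma small_le_segment T (A : set T) :
  A #< [set: k] -> exists c, A #<= segment (@ord_le k) c.
Proof.
move=> AK; apply: contrapT => /forallNP nA.
have {nA}segA c : segment (@ord_le k) c #< A by exact/card_ltNge.
have [a0 _] := infinite_setN0 (@points_infinite k).
have [t0 _] : A !=set0.
  apply/set0P/negP => /eqP A0; have := (segA a0).2; rewrite A0; apply.
  exact: card_ge0.
pose dom (R : set (k * T)) := [set c | exists t, R (c, t)].
pose good (R : set (k * T)) := [/\ forall c t, R (c, t) -> A t,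
  forall c t u, R (c, t) -> R (c, u) -> t = u,
  forall b c t, R (b, t) -> R (c, t) -> b = c &
  forall b c, ord_le b c -> dom R c -> dom R b].
have [|R [[RA Rfun Rinj Rdom] maxR]] := @Zorn_bigcup _ good.
  move=> F Fgood Ftot.
  have two p q : (\bigcup_(X in F) X) p -> (\bigcup_(X in F) X) q ->
      exists Y, [/\ good Y, Y p & Y q].
    move=> [X FX Xp] [Y FY Yq]; have [XY|YX] := Ftot _ _ FX FY.
      by exists Y; split; [exact: Fgood|exact: XY|].
    by exists X; split; [exact: Fgood| |exact: YX].
  split=> [c t Fc|c t u Ft Fu|b c t Fb Fc|b c bc [t [X FX Xc]]].
  - by have [Y [[YA _ _ _] Yc _]] := two _ _ Fc Fc; exact: YA Yc.
  - by have [Y [[_ Yf _ _] Yt Yu]] := two _ _ Ft Fu; exact: Yf Yt Yu.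
  - by have [Y [[_ _ Yi _] Yb Yc]] := two _ _ Fb Fc; exact: Yi Yb Yc.
  - have [_ _ _ Xd] := Fgood _ FX.
    by have [|u Xb] := Xd _ _ bc; [exists t|exists u, X].
have [domT|/existsNP ndom] := pselect (forall c, dom R c).
  have /choice[f fR] := domT.
  have /card_ltNge := AK; apply.
  by apply: (@fun_card_le _ _ _ _ f) => [c _|b c _ _ e]; [exact: RA (fR c)|
    apply: Rinj (fR b) _; rewrite e; exact: fR].
have [c [ndc minc]] := @wo_least _ _ wo [set c | ~ dom R c] ndom.
have domseg : dom R = segment (@ord_le k) c.
  apply/seteqP; split=> b; first by move=> db cb; apply: ndc; exact: Rdom cb db.
  by move=> cb; apply: contrapT => ndb; apply: cb; exact: minc.
have [t [At nRt]] : exists t, A t /\ forall b, ~ R (b, t).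
  apply: contrapT => nt; have /card_ltNge := segA c; apply.
  have /choice[f fR] : forall t, exists b, A t -> R (b, t).
    move=> t; have [At|] := pselect (A t); last by exists a0.
    apply: contrapT => nb; apply: nt; exists t; split=> // b Rb.
    by apply: nb; exists b.
  apply: (@fun_card_le _ _ _ _ f) => [t /fR Rt|t u /fR Rt /fR Ru e].
    by rewrite -domseg; exists t.
  by apply: Rfun Rt _; rewrite e.
apply: (maxR (R `|` [set (c, t)])).
  split; first by move=> p; left.
  by move=> /(_ (c, t)) sub; apply: ndc; exists t; apply: sub; right.
split.
- by move=> b u [/RA//|[_ ->]].
- move=> b u v [Ru|[eb ->]] [Rv|[eb' ->]] //; first exact: Rfun Ru Rv.
    by case: ndc; rewrite -eb'; exists u.
  by case: ndc; rewrite -eb; exists v.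
- move=> b d u [Ru|[-> eu]] [Rv|[-> eu']] //; first exact: Rinj Ru Rv.
    by case: (nRt b); rewrite -eu'.
  by case: (nRt d); rewrite -eu.
- move=> b d bd [u [Rd|[dc _]]].
    by have [|v Rb] := Rdom _ _ bd; [exists u|exists v; left].
  have [->|bc] := pselect (b = c); first by exists t; right.
  suff [v Rb] : dom R b by exists v; left.
  by rewrite domseg => cb; apply: bc; apply: (wo_anti wo); rewrite // -dc.
Qed.

End InfiniteCardinalOrder.

Lemma initial_segment_lt (k : infinite_cardinal) (a : k) :
  [set b | ord_le b a] #< [set: k].
Proof.
have kinf := @points_infinite k.
apply: (@card_le_lt_trans _ _ _ (segment (@ord_le k) a `|` [set a])).
  apply: subset_card_le => b ba; have [->|nab] := pselect (b = a); first by right.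
  by left => ab; apply: nab; exact: (wo_anti (@ord_le_wo k)).
by apply: card_ltU => //; [exact: segment_lt|exact: card_lt_finite].
Qed.

(** * Cofinality and the pigeonhole principle *)

Definition pigeonhole (k : infinite_cardinal) I (S : set I) :=
  forall (K : set k) (f : k -> I), [set: k] #<= K -> (forall a, K a -> S (f a)) ->
  exists2 i, S i & [set: k] #<= K `&` f @^-1` [set i].

Lemma cf_cofinal (k : infinite_cardinal) : cofinal (cf k).
Proof.
apply: (min_cardP _).1; exists setT => a; exists a => //.
exact: (wo_refl (@ord_le_wo k)).
Qed.

Lemma lt_cf_bounded (k : infinite_cardinal) (B : set k) :
  B #< cf k -> exists a, B `<=` segment (@ord_le k) a.
Proof.
move=> /card_ltNge Bcf; apply: contrapT => /forallNP nB; apply: Bcf.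
have Bcof : cofinal B.
  move=> a; apply: contrapT => na; apply: (nB a) => b Bb ab.
  by apply: na; exists b.
by apply: (min_cardP _).2 => //; exists B.
Qed.

Lemma lt_cf_lt (k : infinite_cardinal) T (B : set T) : B #< cf k -> B #< [set: k].
Proof. by move=> /card_lt_le_trans; apply; exact: card_leT. Qed.

(** If all the fibres were small, each would embed in a proper initial segment,
    and fewer than [cf k] such segments lie in a common one. *)
Lemma cf_pigeonhole (k : infinite_cardinal) I (S : set I) :
  S #< cf k -> pigeonhole k S.
Proof.
move=> Scf K f Kbig fS; apply: contrapT => small.
have /choice[c cP] : forall i, exists c : k, S i ->
    K `&` f @^-1` [set i] #<= segment (@ord_le k) c.
  move=> i; have [Si|] := pselect (S i); last first.
    by have [a0 _] := infinite_setN0 (@points_infinite k); exists a0.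
  have [|c ?] := @small_le_segment k _ (K `&` f @^-1` [set i]); last by exists c.
  by apply/card_ltNge => big; apply: small; exists i.
have [|a ca] := @lt_cf_bounded k (c @` S).
  exact: card_le_lt_trans (card_image_le _ _) Scf.
have /card_ltNge : \bigcup_(i in S) (K `&` f @^-1` [set i]) #< [set: k].
  apply: card_lt_bigcup (@points_infinite k) (lt_cf_lt Scf) (segment_lt a) _.
  move=> i Si; apply: card_le_trans (cP _ Si) (subset_card_le _).
  apply: (segmentS (@ord_le_wo k)); have /= := ca (c i) (imageP _ Si).
  by have [] := wo_total (@ord_le_wo k) a (c i).
apply; apply: card_le_trans Kbig (subset_card_le _) => a' Ka'.
by exists (f a') => //; exact: fS.
Qed.

(** The cofinality of [k] is made into a cardinal [nu] of its own, which allows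
    the arguments about [k] to be repeated for it; [nu] is regular, in the form
    of its pigeonhole principle. Let [h] embed [cf k] in [nu]. The initial
    segments of [nu] are smaller than [cf k], so the elements of [cf k] that [h]
    sends to [i] or below are bounded in [k], and [g i] is such a bound. The inverse
    of [h] could not replace [g]: it may send a set of size [nu] to a bounded
    one. *)
Lemma cofinality_cardinal (k : infinite_cardinal) : [set: nat] #< cf k ->
  exists (nu : infinite_cardinal) (g : nu -> k),
  [/\ [set: nu] #= cf k, 
  forall N : set nu, [set: nu] #<= N -> cofinal (g @` N) &
  forall I (S : set I), S #< [set: nu] -> pigeonhole nu S].
Proof.
move=> cfunc; have kwo := @ord_le_wo k.
have [nu nucf] := @exists_infinite_cardinal _ (cf k) ((infiniteP _).2 cfunc.1).
have [a0 _] := infinite_setN0 (@points_infinite k).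
have [j0 _] := infinite_setN0 (@points_infinite nu).
have ltcf T (B : set T) : B #< [set: nu] -> B #< cf k.
  by move=> /card_lt_le_trans; apply; rewrite -(card_le_eqr nucf).
have nuinf := @points_infinite nu; have nuwo := @ord_le_wo nu.
have [h [_ hinj]] : exists h : k -> nu, (forall x, cf k x -> [set: nu] (h x)) /\
    (forall x y, cf k x -> cf k y -> h x = h y -> x = y).
  by apply: (card_le_fun j0); rewrite (card_le_eqr nucf).
have /choice[g gP] : forall i : nu, exists b : k,
    cf k `&` h @^-1` [set j | ord_le j i] `<=` segment (@ord_le k) b.
  move=> i; apply: lt_cf_bounded.
  apply: card_le_lt_trans (ltcf _ _ (initial_segment_lt i)).
  by apply: (@fun_card_le _ _ _ _ h) => [x []//|x y [cx _] [cy _]]; exact: hinj.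
have gcof (N : set nu) : [set: nu] #<= N -> cofinal (g @` N).
  move=> Nbig a; have [c cfc ac] := cf_cofinal a.
  have [i Ni ci] : exists2 i, N i & ord_le (h c) i.
    apply: contrapT => nN; have /card_ltNge := segment_lt (h c); apply.
    apply: card_le_trans Nbig (subset_card_le _) => i Ni ci.
    by apply: nN; exists i.
  exists (g i); first by exists i.
  apply: (wo_trans kwo ac); have [//|gc] := wo_total kwo c (g i).
  by case: (gP i c).
exists nu, g; split=> // I S /ltcf Scf K f Kbig fS.
apply: contrapT => small.
have /choice[b bP] : forall i, exists b : k, S i ->
    g @` (K `&` f @^-1` [set i]) `<=` segment (@ord_le k) b.
  move=> i; have [Si|] := pselect (S i); last by exists a0.
  have [|b ?] := @lt_cf_bounded k (g @` (K `&` f @^-1` [set i])).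
    apply: card_le_lt_trans (card_image_le _ _) (ltcf _ _ _).
    by apply/card_ltNge => big; apply: small; exists i.
  by exists b.
have [|a ba] := @lt_cf_bounded k (b @` S).
  exact: card_le_lt_trans (card_image_le _ _) Scf.
have [_ [i Ki <-] ai] := gcof _ Kbig a.
apply: (ba (b (f i))); first by exists (f i) => //; exact: fS.
apply: (wo_trans kwo ai); have [//|bg] := wo_total kwo (g i) (b (f i)).
by case: (bP (f i) (fS _ Ki) (g i)) => //; exists i.
Qed.

(** * Colouring finite sets *)

Section Coloring.
Variable L : eqType.

Definition colorable k (K : set k) (F : k -> seq L) :=
  exists q : L -> nat, forall a, K a -> {in F a &, injective q}.

(** A maximal disjoint subfamily is either large, or has a small union which
    meets all the other sets; removing this union from them lowers the bound on
    their sizes. *)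
Lemma disjoint_outside_small (k : infinite_cardinal) n (K : set k) (F : k -> seq L) :
  [set: nat] #< [set: k] -> [set: k] #<= K -> (forall a, K a -> size (F a) <= n) ->
  exists (K' : set k) (D : set L), [/\ K' `<=` K, [set: k] #<= K', D #< [set: k] &
    forall a b x, K' a -> K' b -> x \in F a -> x \in F b -> a = b \/ D x].
Proof.
move=> kunc; have kinf := @points_infinite k.
elim: n K F => [|n IHn] K F Kbig Fn.
  exists K, set0; split=> //; first exact: card_lt_finite.
  by move=> a b x /Fn; rewrite leqn0 size_eq0 => /eqP ->.
have [E [EK Edisj Emax]] := ex_maximal_disjoint_subcollection (fun a => [set` F a]) K.
have [Ebig|/card_ltNge Esmall] := pselect ([set: k] #<= E).
  exists E, set0; split=> //; first exact: card_lt_finite.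
  by move=> a b x Ea Eb xa xb; left; apply: Edisj => //; exists x.
pose D := \bigcup_(a in E) [set` F a].
have Dsmall : D #< [set: k].
  apply: card_lt_bigcup kinf Esmall kunc _ => a _.
  exact/finite_set_countable/finite_seq.
have KEbig : [set: k] #<= K `\` E.
  apply: contrapT => /card_ltNge KEsmall.
  have /card_ltNge := card_ltU kinf Esmall KEsmall; apply.
  by rewrite setDUK.
pose F' a := [seq x <- F a | `[< ~ D x >]].
have [|a [Ka nEa]|K' [D' [K'K K'big D'small K'D']]] := IHn (K `\` E) F' => //.
  rewrite -ltnS; apply: leq_trans (Fn _ Ka).
  rewrite size_filter -(count_predC (fun x => `[< ~ D x >])) -addn1 leq_add2l.
  rewrite -has_count; apply/hasP; apply: contrapT => nD.
  apply: (Emax (a |` E)); first split.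
  - by move=> b; right.
  - by move=> /(_ a); apply: contra_not nEa; apply; left.
  - by move=> b [->//|/EK].
  move=> b c + + [x [/= xb xc]].
  have nFa b' x' : E b' -> x' \in F b' -> x' \in F a -> False.
    move=> Eb' xb' xa; apply: nD; exists x' => //=.
    by apply/negP => /asboolP; apply; exists b'.
  move=> [ba|Eb] [ca|Ec]; first by rewrite ba ca.
  - by move: xb; rewrite ba => /(nFa c x Ec xc).
  - by move: xc; rewrite ca => /(nFa b x Eb xb).
  - by apply: Edisj => //; exists x.
exists K', (D `|` D'); split=> //.
- by move=> a /K'K[].
- exact: card_ltU.
- move=> a b x K'a K'b xa xb; have [Dx|nDx] := pselect (D x); first by right; left.
  have [||->|] := K'D' a b x K'a K'b; rewrite ?mem_filter ?xa ?xb ?andbT.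
  + exact/asboolP.
  + exact/asboolP.
  + by left.
  + by right; right.
Qed.

(** Outside [D] a point belongs to at most one of the sets, so its rank in that
    set is a colour; parity separates these colours from those used on [D]. *)
Lemma colorable_extend k (K : set k) (D : set L) (F : k -> seq L) :
  (forall a b x, K a -> K b -> x \in F a -> x \in F b -> a = b \/ D x) ->
  colorable K (fun a => [seq x <- F a | `[< D x >]]) -> colorable K F.
Proof.
move=> disj [q qP].
have /choice[r rP] : forall x, exists n, forall a, K a -> x \in F a -> ~ D x ->
    n = index x (F a).
  move=> x; have [[a [Ka xa nDx]]|none] :=
      pselect (exists a, [/\ K a, x \in F a & ~ D x]).
    by exists (index x (F a)) => b Kb xb _; have [->|] := disj a b x Ka Kb xa xb.
  by exists 0 => a Ka xa nDx; case: none; exists a.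
exists (fun x => if pselect (D x) then (q x).*2 else (r x).*2.+1).
move=> a Ka x y xa ya; case: pselect => Dx; case: pselect => Dy.
- move=> /double_inj; apply: (qP a) => //; rewrite mem_filter ?xa ?ya andbT;
  exact/asboolP.
- by move=> /(congr1 odd); rewrite /= !odd_double.
- by move=> /(congr1 odd); rewrite /= !odd_double.
- move=> [/double_inj]; rewrite (rP x a) // (rP y a) // => /(congr1 (nth x (F a))).
  by rewrite !nth_index.
Qed.

(** The part of the colouring theorem that concerns the traces on a small
    set [D]; it is where regular and singular cardinals differ. *)
Definition small_colorable (k : infinite_cardinal) :=
  forall (K : set k) (D : set L) (G : k -> seq L), [set: k] #<= K -> D #< [set: k] ->
  (forall a, K a -> [set` G a] `<=` D) ->
  exists K' : set k, [/\ K' `<=` K, [set: k] #<= K' & colorable K' G].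

(** [disjoint_outside_small] needs a uniform bound on the sizes of the sets, which
    the pigeonhole principle for [nat] provides. *)
Lemma coloring_of_small (k : infinite_cardinal) (F : k -> seq L) :
  [set: nat] #< [set: k] -> pigeonhole k [set: nat] -> small_colorable k ->
  exists2 K : set k, [set: k] #<= K & colorable K F.
Proof.
move=> kunc pig small.
have [n _ Kbig] := pig setT (size \o F) (card_lexx _) (fun _ _ => I).
have [|K' [D [K'K K'big Dsmall K'D]]] := @disjoint_outside_small k n _ F kunc Kbig.
  by move=> a [_ /= ->].
have [|K'' [K''K' K''big K''col]] :=
    @small K' D (fun a => [seq x <- F a | `[< D x >]]) K'big Dsmall.
  by move=> a _ x /=; rewrite mem_filter => /andP[/asboolP].
exists K'' => //; apply: (@colorable_extend _ _ D) => //.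
by move=> a b x /K''K' Ka /K''K' Kb; exact: K'D.
Qed.

Lemma fiber_colorable k (K : set k) (G : k -> seq L) s :
  (forall a, K a -> G a = s) -> colorable K G.
Proof.
move=> Gs; exists (fun x => index x s) => a /Gs -> x y xs ys.
by move=> /(congr1 (nth x s)); rewrite !nth_index.
Qed.

Definition words (D : set L) n := [set s : seq L | size s = n /\ [set` s] `<=` D].

Lemma small_colorable_regular (k : infinite_cardinal) :
  [set: nat] #< [set: k] ->
  (forall I (S : set I), S #< [set: k] -> pigeonhole k S) -> small_colorable k.
Proof.
move=> kunc pig K D G Kbig Dsmall GD.
have [n _ Kn] := pig _ _ kunc K (size \o G) Kbig (fun _ _ => I).
have Wsmall := @card_lt_seq _ _ D _ n (@points_infinite k) Dsmall.
have [|s _ Ks] := pig _ _ Wsmall _ G Kn.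
  by move=> a [Ka <-]; split=> //; exact: GD.
exists (K `&` (size \o G) @^-1` [set n] `&` G @^-1` [set s]).
split=> //; first by move=> a [[]].
by apply: (@fiber_colorable _ _ _ s) => a [].
Qed.

(** For each [i] some word [s i] has a fibre [fib (s i)] larger than the segment
    below [g i]: otherwise [K] would be a union of few sets no larger than that
    segment. If the words [s i] are coloured together for [nu] many indices
    [i], the union of their fibres exceeds segments cofinal in [k], so it has
    size [k]. *)
Lemma small_colorable_cofinal (k nu : infinite_cardinal) (g : nu -> k) :
  pigeonhole k [set: nat] ->
  (forall N : set nu, [set: nu] #<= N -> cofinal (g @` N)) ->
  (forall F : nu -> seq L, exists2 N : set nu, [set: nu] #<= N & colorable N F) ->
  small_colorable k.
Proof.
move=> pig gcof col K D G Kbig Dsmall GD; have kinf := @points_infinite k.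
have [n _ Kn] := pig K (size \o G) Kbig (fun _ _ => I).
have Wsmall := @card_lt_seq _ _ D _ n kinf Dsmall.
set K0 := K `&` _ in Kn; pose fib s := K0 `&` G @^-1` [set s].
have K0G a : K0 a -> fib (G a) a by [].
have /choice[s sP] : forall i, exists s, segment (@ord_le k) (g i) #< fib s.
  move=> i; apply: contrapT => /forallNP nfib.
  have /card_ltNge : \bigcup_(s in words D n) fib s #< [set: k].
    apply: card_lt_bigcup kinf Wsmall (segment_lt (g i)) _ => s _.
    by apply: contrapT => /card_ltNge; exact: nfib.
  apply; apply: card_le_trans Kn (subset_card_le _) => a K0a.
  exists (G a) => //; split; first by case: K0a.
  by apply: GD; case: K0a.
have [N Nbig [q qN]] := col s.
exists (\bigcup_(i in N) fib (s i)); split.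
- by move=> a [i _ [[]]].
- apply: contrapT => /card_ltNge/small_le_segment[c ac].
  have [_ [i Ni <-] ci] := gcof _ Nbig c.
  have /card_ltNge := sP i; apply.
  apply: card_le_trans (subset_card_le (segmentS (@ord_le_wo k) ci)).
  by apply: card_le_trans ac; apply: subset_card_le => a; exists i.
- by exists q => a [i Ni [_ ->]]; exact: qN.
Qed.

End Coloring.

(** A substitute for the Delta-system lemma which is also valid for singular [k]
    of uncountable cofinality. *)
Theorem coloring (k : infinite_cardinal) (L : eqType) (F : k -> seq L) :
  [set: nat] #< cf k -> exists2 K : set k, [set: k] #<= K & colorable K F.
Proof.
move=> cfunc; have [nu [g [nucf gcof nupig]]] := cofinality_cardinal cfunc.
have nuunc : [set: nat] #< [set: nu].
  by apply: card_lt_le_trans cfunc _; rewrite (card_le_eqr nucf).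
have kpig := cf_pigeonhole cfunc.
apply: coloring_of_small (kpig) _; first exact: lt_cf_lt.
apply: small_colorable_cofinal kpig gcof _ => G.
apply: coloring_of_small (nupig _ _ nuunc) _ => //.
exact: small_colorable_regular.
Qed.

(** * The three caliber properties in terms of indices *)

(** Which subfamilies, given by their sets of indices, must have a common point:
    the three properties differ only in this respect, see [family_propP]. *)
Definition tested (A : caliber_kind) I (H : set I) : Prop :=
  match A with
  | Caliber => True
  | Precaliber => finite_set H
  | WeakPrecaliber => exists a b, H = [set a; b]
  end.

Lemma family_propP (A : caliber_kind) T I (U : I -> set T) (J : set I) :
  J !=set0 ->
  family_prop A (U @` J) <-> (forall H, H `<=` J -> H !=set0 -> tested A H ->
    \bigcap_(a in H) U a !=set0).
Proof.
move=> J0; case: A => /=.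
- rewrite /has_common_point bigcap_image; split=> [[x Jx] H HJ _ _|/(_ J)]; last exact.
  by exists x => a /HJ; exact: Jx.
- split=> [cU H HJ H0 finH|tU G finG [B0 GB0] GU].
    rewrite -(bigcap_image H U id); apply: cU.
    + exact: finite_image.
    + by case: H0 => a Ha; exists (U a), a.
    + by move=> _ [a Ha <-]; exists a => //; exact: HJ.
  have [a0 _] := J0.
  have /choice[f fP] : forall B, exists a, G B -> J a /\ U a = B.
    move=> B; have [/GU[a Ja <-]|] := pselect (G B); first by exists a.
    by exists a0.
  have [|||x xP] := tU (f @` G).
  + by move=> _ [B /fP[? _] <-].
  + by exists (f B0), B0.
  + exact: finite_image.
  by exists x => B GB; have := xP (f B) (imageP _ GB); rewrite (fP _ GB).2.
- split=> [lU H + _ [a [b Hab]]|tU _ _ [a Ja <-] [b Jb <-]].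
    rewrite Hab => abJ; rewrite bigcap_setU !bigcap_set1.
    by apply: lU; apply: imageP; apply: abJ; [left|right].
  have [|||x xP] := tU [set a; b].
  + by move=> _ [] ->.
  + by exists a; left.
  + by exists a, b.
  by exists x; split; apply: xP; [left|right].
Qed.

Lemma family_propS (A : caliber_kind) T I (U : I -> set T) (J J' : set I) :
  J' !=set0 -> J' `<=` J -> family_prop A (U @` J) -> family_prop A (U @` J').
Proof.
move=> J'0 J'J; have J0 : J !=set0 by case: J'0 => a /J'J; exists a.
move=> /(family_propP _ _ J0) UJ; apply/(family_propP _ _ J'0) => H HJ'.
by apply: UJ; exact: subset_trans HJ' J'J.
Qed.

Lemma family_prop_linked (A : caliber_kind) T (F : set (set T)) :
  family_prop A F -> linked F.
Proof.
case: A => //= [[x Fx]|cF] B C FB FC.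
  by exists x; split; exact: Fx.
rewrite -(bigcap_set1 id B) -(bigcap_set1 id C) -bigcap_setU.
by apply: cF => [|| D [] ->] //; exists B; left.
Qed.

Lemma large_nonempty (k : infinite_cardinal) T (J : set T) :
  [set: k] #<= J -> J !=set0.
Proof.
move=> Jbig; apply: infinite_setN0 => /(card_le_finite Jbig).
exact: points_infinite.
Qed.

Lemma calibers_subset (A : caliber_kind) (X : topologicalType) (k : infinite_cardinal)
    (K : set k) (U : k -> set X) : calibers A X k -> [set: k] #<= K ->
  (forall a, K a -> nonempty_opens X (U a)) ->
  exists J : set k, [/\ J `<=` K, [set: k] #<= J & family_prop A (U @` J)].
Proof.
move=> cal Kbig UK; have [a0 _] := infinite_setN0 (@points_infinite k).
have [e [eK einj]] := card_le_fun a0 Kbig.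
have [|J Jk UJ] := cal (U \o e); first by move=> a; exact/UK/eK.
exists (e @` J); split.
- by move=> _ [a _ <-]; exact: eK.
- have : e @` J #= [set: k].
    by apply: card_eq_trans Jk; apply: inj_card_eq => x y _ _; exact: einj.
  by rewrite card_eq_le => /andP[].
- by rewrite image_comp.
Qed.

Lemma calibers_finite (A : caliber_kind) (X : topologicalType) (k : infinite_cardinal)
    (K : set k) n (V : nat -> k -> set X) : calibers A X k -> [set: k] #<= K ->
  (forall c a, K a -> nonempty_opens X (V c a)) ->
  exists J : set k, [/\ J `<=` K, [set: k] #<= J &
    forall c, (c < n)%N -> family_prop A (V c @` J)].
Proof.
move=> cal Kbig VK; elim: n => [|n [J [JK Jbig VJ]]].
  by exists K; split=> // c; rewrite ltn0.
have [|J' [J'J J'big VJ']] := @calibers_subset _ _ _ _ (V n) cal Jbig.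
  by move=> a /JK; exact: VK.
exists J'; split=> [| |c] //; first exact: subset_trans J'J JK.
rewrite ltnS leq_eqVlt => /predU1P[-> //|cn].
by apply: family_propS (VJ _ cn) => //; exact: large_nonempty J'big.
Qed.

(** * Powers of a space *)

Section Power.
Variables (I : Type) (i0 : I) (X : topologicalType).
Local Notation Y := ({ptws I -> X} : topologicalType).

Definition box (F : seq {classic I}) (B : I -> set X) : set Y :=
  [set x | forall i, i \in F -> B i (x i)].

(** The sets that contain a box around [p] form a filter which converges to [p],
    since it does so in each coordinate. *)
Lemma open_box (U : set Y) (p : Y) : open U -> U p ->
  exists (F : seq {classic I}) (B : I -> set X),
    (forall i, open (B i) /\ B i (p i)) /\ box F B `<=` U.
Proof.
move=> oU Up.
pose Phi : set_system Y := [set W | exists (F : seq {classic I}) (B : I -> set X),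
    (forall i, open (B i) /\ B i (p i)) /\ box F B `<=` W].
have Phifilter : Filter Phi.
  split.
  - by exists [::], (fun=> setT); split=> // i; split=> //; exact: openT.
  - move=> P Q [F [B [Bp BP]]] [G [C [Cp CQ]]].
    exists (F ++ G), (fun i => B i `&` C i); split=> [i|x xFG].
      by split; [exact: openI (Bp i).1 (Cp i).1|split; [exact: (Bp i).2|exact: (Cp i).2]].
    by split; [apply: BP|apply: CQ] => i iF; have [] := xFG i _;
      rewrite // mem_cat iF ?orbT.
  - move=> P Q PQ [F [B [Bp BP]]]; exists F, B; split=> //.
    exact: subset_trans BP PQ.
suff /(_ U) : Phi --> p by apply; exact: open_nbhs_nbhs.
apply/cvg_sup => i W [V [[B oB <-] Bpi BW]].
exists [:: i], (fun j => if pselect (j = i) then B else setT); split=> [j|x xi].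
  by case: pselect => [ji|_] /=; [rewrite ji|split=> //; exact: openT].
by apply: BW; have := xi i (mem_head _ _); case: pselect.
Qed.

Lemma eval_open (i : I) (B : set X) : open B -> open [set x : Y | B (x i)].
Proof.
move=> oB; apply: (@open_comp Y X (fun x => x i)) => // x _.
exact: (@proj_continuous {classic I} (fun _ => X) i).
Qed.

Lemma finite_eval_open (J : eqType) (F : seq J) (e : J -> I) (B : J -> set X) :
  (forall j, open (B j)) -> open [set x : Y | forall j, j \in F -> B j (x (e j))].
Proof.
move=> oB; elim: F => [|j F IHF].
  by rewrite (_ : mkset _ = setT); [exact: openT|apply/seteqP].
rewrite (_ : mkset _ = [set x : Y | B j (x (e j))] `&`
    [set x : Y | forall j, j \in F -> B j (x (e j))]).
  by apply: openI IHF; exact: eval_open.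
apply/seteqP; split=> x.
  by move=> xF; split=> [|i iF]; apply: xF; rewrite inE ?eqxx ?iF ?orbT.
by move=> [xj xF] i; rewrite inE => /predU1P[->//|]; exact: xF.
Qed.

Lemma precomp_open (e : I -> I) (U : set Y) : open U -> open [set x : Y | U (x \o e)].
Proof.
move=> oU; rewrite openE => x Ux.
have [F [B [Bx BU]]] := open_box oU Ux.
pose V := [set y : Y | forall i, i \in F -> B i (y (e i))].
apply: (@filterS _ _ _ V); first by move=> y Vy; exact: BU.
apply: open_nbhs_nbhs; split; last by move=> i _; exact: (Bx i).2.
by apply: finite_eval_open => i; exact: (Bx i).1.
Qed.

(** Thin the family so that the supports of the boxes inside the [U a] are
    coloured with fewer than [n] colours. The sides of the [a]-th box are then
    [V c a] for [c < n], and the property for [X] is used once for every [c]. *)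
Lemma calibers_power (A : caliber_kind) (k : infinite_cardinal) :
  [set: nat] #< cf k -> calibers A X k -> calibers A Y k.
Proof.
move=> cfunc cal U oU.
have /choice[p Up] : forall a, exists p, U a p by move=> a; exact: (oU a).2.
have /choice[F /choice[B FB]] := fun a => open_box (oU a).1 (Up a).
have [K Kbig [q qK]] := coloring F cfunc.
pose bound a := \max_(i <- F a) (q i).+1.
have [n _ Kn] := cf_pigeonhole cfunc (f := bound) Kbig (fun _ _ => Logic.I).
set K' := K `&` _ in Kn.
have qn a i : K' a -> i \in F a -> (q i < n)%N.
  by move=> [_ <-] iF; rewrite /bound (big_rem i) //= leq_maxl.
(* For [a] in [K'] at most one [i] in the support has colour [c], so [V c a] is
   [B a i] for that [i], and the whole space if there is none. *)
pose V c a : set X := [set t | forall i, i \in F a -> q i = c -> B a i t].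
have V_open c a : K' a -> nonempty_opens X (V c a).
  move=> [Ka _]; have [[i [iF qi]]|none] := pselect (exists i, i \in F a /\ q i = c).
    have -> : V c a = B a i.
      apply/seteqP; split=> [t|t Bt j jF qj]; first exact.
      by rewrite -(qK a Ka i j) // qi qj.
    by split; [exact: ((FB a).1 i).1|exists (p a i); exact: ((FB a).1 i).2].
  have -> : V c a = setT.
    by apply/seteqP; split=> // t _ i iF qi; case: none; exists i.
  split; first exact: openT.
  by exists (p a i0).
have [J [JK' Jbig VJ]] := calibers_finite n cal Kn V_open.
exists J; first by apply/card_eqPle; split=> //; exact: card_leT.
have J0 := large_nonempty Jbig; apply/(family_propP _ _ J0) => H HJ H0 Htest.
have /choice[t tP] : forall c, exists t, (c < n)%N -> (\bigcap_(a in H) V c a) t.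
  move=> c; have [cn|_] := ltnP c n; last first.
    by case: H0 => a _; exists (p a i0).
  by have [t Vt] := (family_propP A _ J0).1 (VJ _ cn) _ HJ H0 Htest; exists t.
exists (fun i => t (q i)) => a Ha; have [_ boxU] := FB a; apply: boxU => i iF.
exact: (tP _ (qn _ _ (JK' _ (HJ _ Ha)) iF) a Ha).
Qed.

Lemma calibers_factor (A : caliber_kind) (k : infinite_cardinal) :
  calibers A Y k -> calibers A X k.
Proof.
move=> cal U oU.
have [|J Jk UJ] := cal (fun a => [set x : Y | U a (x i0)]).
  move=> a; split; first exact: eval_open (oU a).1.
  by have [t Ut] := (oU a).2; exists (fun=> t).
exists J => //; have J0 : J !=set0.
  by apply: (@large_nonempty k); move: Jk => /card_eqPle[].
apply/(family_propP _ _ J0) => H HJ H0 Htest.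
have [x Ux] := (family_propP A _ J0).1 UJ _ HJ H0 Htest.
by exists (x i0) => a /Ux.
Qed.

(** With [O] and [O'] disjoint open sets of [X], the [n]-th set prescribes [O] on
    the first [n] of infinitely many coordinates and [O'] on the next one. *)
Lemma disjoint_opens_power : infinite_set [set: I] -> hausdorff_space X ->
  (exists x y : X, x <> y) ->
  exists V : nat -> set Y, (forall n, nonempty_opens Y (V n)) /\
    forall m n, V m `&` V n !=set0 -> m = n.
Proof.
move=> infI; rewrite open_hausdorff => T2 [x0 [y0 /eqP/T2]].
move=> [[/= O O'] [/set_mem Ox /set_mem O'y] [oO oO' OO']].
have [e [_ einj]] := card_le_fun i0 ((infiniteP _).1 infI).
pose V n : set Y := [set x : Y | forall m, m \in iota 0 n -> O (x (e m))] `&`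
  [set x : Y | O' (x (e n))].
exists V; split=> [n|m n].
  split.
    by apply: openI; [exact: (@finite_eval_open nat _ e (fun=> O))|exact: eval_open].
  exists (fun i => if pselect (i = e n) then y0 else x0); split=> /=.
    move=> m; rewrite mem_iota add0n => /andP[_ mn]; case: pselect => // em.
    by rewrite (einj _ _ Logic.I Logic.I em) ltnn in mn.
  by case: pselect.
have lt_disj i j x : V i x -> V j x -> ~~ (i < j)%N.
  move=> [_ /= O'x] [Vj _]; apply/negP => ij.
  have : (O `&` O') (x (e i)) by split=> //; apply: Vj; rewrite mem_iota.
  by rewrite (eqP OO').
move=> [x [Vm Vn]]; have := lt_disj _ _ _ Vm Vn; have := lt_disj _ _ _ Vn Vm.
by case: ltngtP.
Qed.

End Power.

(** If [cf k] embeds in [nat] by [h], give index [a] the set [V (h (c a))], where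
    [c a] is an element of [cf k] above [a]. Members of a linked subfamily all
    share the same [c a], so their indices are bounded in [k]. *)
Lemma calibers_uncountable_cf (A : caliber_kind) (Y : topologicalType)
    (V : nat -> set Y) (k : infinite_cardinal) :
  (forall n, nonempty_opens Y (V n)) ->
  (forall m n, V m `&` V n !=set0 -> m = n) ->
  calibers A Y k -> [set: nat] #< cf k.
Proof.
move=> oV disjV cal; apply/card_ltNge => /(card_le_fun 0)[h [_ hinj]].
have /choice[c cP] : forall a : k, exists b, cf k b /\ ord_le a b.
  by move=> a; have [b cfb ab] := cf_cofinal a; exists b.
have [a|J /card_eqPle[_ Jbig] /family_prop_linked UJ] := cal (fun a => V (h (c a))).
  exact: oV.
have [a Ja] := large_nonempty Jbig.
have /card_ltNge := initial_segment_lt (c a); apply.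
apply: card_le_trans Jbig (subset_card_le _) => b Jb /=.
have /disjV : V (h (c a)) `&` V (h (c b)) !=set0 by apply: UJ; exact: imageP.
by move=> /hinj ->; [exact: (cP b).2|exact: (cP a).1|exact: (cP b).1].
Qed.

(** * Calibers and calibers* *)

Lemma calibers_star_of_calibers (A : caliber_kind) (Y : topologicalType)
  (k : infinite_cardinal) : calibers A Y k -> calibers_star A Y k.
Proof.
move=> cal UU oUU UUk; have /card_eqPle[_ kUU] := UUk.
have [U [UUU Uinj]] := card_le_fun (set0 : set Y) kUU.
have [a|J Jk UJ] := cal U; first exact/oUU/UUU.
exists (U @` J); split=> //; first by move=> _ [a _ <-]; exact: UUU.
apply: card_eq_trans Jk; apply: inj_card_eq => a b _ _; exact: Uinj.
Qed.

(** The maps [f] and [g] stand for the two projections of a homeomorphism of [Y]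
    with its square. The pairing with distinct [W a] turns the indexed
    family [U] into a set of [k] distinct opens. *)
Lemma calibers_of_star (A : caliber_kind) (Y : topologicalType)
    (f g : Y -> Y) (k : infinite_cardinal) :
  (forall U, open U -> open (f @^-1` U)) -> (forall U, open U -> open (g @^-1` U)) ->
  (forall u w, exists x, f x = u /\ g x = w) ->
  [set: k] #<= opens Y -> calibers_star A Y k -> calibers A Y k.
Proof.
move=> fo go fg kY cal U oU; have kinf := @points_infinite k.
have kY0 : [set: k] #<= nonempty_opens Y.
  apply: contrapT => /card_ltNge small.
  have fin : [set (set0 : set Y)] #< [set: k] by exact: card_lt_finite.
  have /card_ltNge := card_ltU kinf small fin; apply.
  apply: card_le_trans kY (subset_card_le _) => V oV.
  by have [->|/set0P V0] := eqVneq V set0; [right|left].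
have [W [oW Winj]] := card_le_fun (set0 : set Y) kY0.
pose Z a := f @^-1` U a `&` g @^-1` W a.
have Zinj : injective Z.
  have ZW a b : Z a = Z b -> W a `<=` W b.
    move=> Zab w Ww; have [u Uu] := (oU a).2; have [x [fx gx]] := fg u w.
    have : Z a x by split; rewrite /preimage /= ?fx ?gx.
    by rewrite Zab => -[_]; rewrite /preimage /= gx.
  by move=> a b Zab; apply: Winj => //; apply/seteqP; split; exact: ZW.
have [| |VV [VVZ VVk VVA]] := cal (Z @` [set: k]).
- move=> _ [a _ <-]; split.
    by apply: openI; [apply/fo/(oU a).1|apply/go/(oW a Logic.I).1].
  have [u Uu] := (oU a).2; have [w Ww] := (oW a Logic.I).2.
  by have [x [fx gx]] := fg u w; exists x; split; rewrite /preimage /= ?fx ?gx.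
- by apply: inj_card_eq => a b _ _; exact: Zinj.
pose J := Z @^-1` VV.
have ZJ : Z @` J = VV.
  by apply/seteqP; split=> [_ [a Ja <-]//|B VB]; have [a _ Za] := VVZ _ VB;
    exists a => //; rewrite /J /preimage /= Za.
have Jk : J #= [set: k].
  apply: card_eq_trans VVk; rewrite -ZJ; apply: card_esym.
  by apply: inj_card_eq => a b _ _; exact: Zinj.
exists J => //; have J0 : J !=set0.
  by apply: (@large_nonempty k); move: Jk => /card_eqPle[].
apply/(family_propP _ _ J0) => H HJ H0 Htest; rewrite -ZJ in VVA.
have [x Zx] := (family_propP A _ J0).1 VVA _ HJ H0 Htest.
by exists (f x) => a /Zx[].
Qed.

Lemma infinite_double T : infinite_set [set: T] ->
  exists e e' : T -> T, [/\ injective e, injective e' & forall x y, e x <> e' y].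
Proof.
move=> infT; have [t0 _] := infinite_setN0 infT.
have [g [_ ginj]] := card_le_fun t0 ((infiniteP _).1 infT).
have [r [_ rinj]] := card_le_fun t0 (infinite_square_le infT).
exists (fun x => r (g 0%N, x)), (fun x => r (g 1%N, x)); split=> x y.
- by move=> /rinj - /(_ (conj Logic.I Logic.I) (conj Logic.I Logic.I)) [].
- by move=> /rinj - /(_ (conj Logic.I Logic.I) (conj Logic.I Logic.I)) [].
- move=> /rinj - /(_ (conj Logic.I Logic.I) (conj Logic.I Logic.I)) [].
  by move=> /ginj - /(_ Logic.I Logic.I).
Qed.

Theorem corollary5p18 (lambda : infinite_cardinal) (X : topologicalType)
    (X_hausdorff : hausdorff_space X)
    (X_gt1 : exists x y : X, x <> y)
    (phi : topologicalType -> Type)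
    (phiE : phi = weight \/ phi = network_weight)
    (oX : opens X #= [set: set (phi X)])
    (A : caliber_kind) :
  let Xlambda : topologicalType := {ptws lambda -> X} in
  let mu := opens Xlambda in
  (forall k : infinite_cardinal,
    calibers A Xlambda k <-> calibers A X k /\ [set: nat] #< cf k) /\
  (forall k : infinite_cardinal,
    calibers_star A Xlambda k <->
      mu #< [set: k] \/
      [/\ calibers A X k, [set: k] #<= mu & [set: nat] #< cf k]).
Proof.
have lambdainf := @points_infinite lambda.
have [i0 _] := infinite_setN0 lambdainf.
move=> Y mu.
have calibersY k : calibers A Y k <-> calibers A X k /\ [set: nat] #< cf k.
  split=> [cal|[cal cfk]]; last exact: calibers_power.
  have [V [oV Vdisj]] := disjoint_opens_power i0 lambdainf X_hausdorff X_gt1.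
  by split; [exact: calibers_factor cal|exact: calibers_uncountable_cf oV Vdisj cal].
split=> // k; split=> [star|[/card_ltNge muk UU oUU /card_eqPle[_ kUU]|[cal kmu cfk]]].
- have [kmu|/card_ltNge] := pselect ([set: k] #<= mu); [right|by left].
  have [e [e' [einj e'inj ee']]] := infinite_double lambdainf.
  have /calibersY[] // : calibers A Y k.
  apply: (@calibers_of_star A Y (fun x => x \o e) (fun x => x \o e')) => //.
  + exact: precomp_open.
  + exact: precomp_open.
  move=> u w.
  exists (fun i => if pselect (exists j, i = e j) is left h then u (projT1 (cid h))
    else if pselect (exists j, i = e' j) is left h then w (projT1 (cid h)) else u i).
  split; apply/funext => i /=.
    case: pselect => [h|[]]; last by exists i.
    by case: cid => j /= /einj ->.
  case: pselect => [[j /esym/ee']//|_].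
  case: pselect => [h|[]]; last by exists i.
  by case: cid => j /= /e'inj ->.
- case: muk; apply: card_le_trans kUU (subset_card_le _) => V /oUU[].
  exact.
- by apply: calibers_star_of_calibers; apply/calibersY.
Qed.
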